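(* Let $\mathfrak{D}_n$ denote the set of desarrangements of length $n$, and define the exponential generating function \[ D^{\mathrm{des}}(t,x)=\sum_{n=0}^{\infty}\sum_{\pi\in\mathfrak{D}_n}t^{\mathrm{des}(\pi)}\frac{x^n}{n!}. \] Then \[ D^{\mathrm{des}}(t,x)=\frac{(1-t)(1-2t-e^{-tx}+e^{(t-1)x})}{(1-2t)(e^{(t-1)x}-t)}. \]
   Context: Permutations $\pi\in\mathfrak{S}_n$ are written in one-line notation $\pi=\pi_1\pi_2\cdots\pi_n$; $\mathfrak{S}_0$ consists of the empty permutation. An index $i\in[n-1]$ is a descent of $\pi$ if $\pi_i>\pi_{i+1}$, and $\mathrm{des}(\pi)$ is the number of descents. An index $i\in[n]$ is an ascent of $\pi$ if it is not a descent (so $n$ is always an ascent). A permutation is a desarrangement if its first (smallest) ascent is even; the empty permutation is also considered a desarrangement. The identity is an identity of formal power series in $x$ with coefficients in $\mathbb{Q}(t)$. *)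

(* Defs.v *)
From HB Require Import structures.
From mathcomp Require Import all_boot all_order all_algebra all_fingroup.
From mathcomp Require Import boolp.

Set Implicit Arguments.
Unset Strict Implicit.
Unset Printing Implicit Defensive.

Import GRing.Theory.
Local Open Scope ring_scope.

(* Formal power series in one variable x.  The coefficient sequence is wrapped
   in a record so that multiplication is the Cauchy product and does not clash
   with pointwise structures on functions.                                    *)
Record fps (R : Type) := Fps { fps_coef : nat -> R }.

Lemma fpsP (R : Type) (a b : fps R) :
  (forall n, fps_coef a n = fps_coef b n) -> a = b.
Proof.
by case: a b => [a] [b] /= ab; congr Fps; apply: functional_extensionality_dep.
Qed.

HB.instance Definition _ (R : Type) := gen_eqMixin (fps R).
HB.instance Definition _ (R : Type) := gen_choiceMixin (fps R).

Section FpsRing.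
Variable R : comNzRingType.
Implicit Types a b c : fps R.

Definition fps_zero : fps R := Fps (fun=> 0).
Definition fps_opp a : fps R := Fps (fun n => - fps_coef a n).
Definition fps_add a b : fps R := Fps (fun n => fps_coef a n + fps_coef b n).

Lemma fps_addA : associative fps_add.
Proof. by move=> a b c; apply: fpsP => n /=; rewrite addrA. Qed.
Lemma fps_addC : commutative fps_add.
Proof. by move=> a b; apply: fpsP => n /=; rewrite addrC. Qed.
Lemma fps_add0 : left_id fps_zero fps_add.
Proof. by move=> a; apply: fpsP => n /=; rewrite add0r. Qed.
Lemma fps_addN : left_inverse fps_zero fps_opp fps_add.
Proof. by move=> a; apply: fpsP => n /=; rewrite addNr. Qed.

HB.instance Definition _ :=
  GRing.isZmodule.Build (fps R) fps_addA fps_addC fps_add0 fps_addN.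

Definition fpsC (c : R) : fps R := Fps (fun n => if n == 0%N then c else 0).

Definition fps_mul a b : fps R :=
  Fps (fun n => \sum_(i < n.+1) fps_coef a i * fps_coef b (n - i)%N).

Let trunc m a : {poly R} := \poly_(i < m.+1) fps_coef a i.

Let coef_trunc m a n : (n <= m)%N -> (trunc m a)`_n = fps_coef a n.
Proof. by move=> le_nm; rewrite coef_poly ltnS le_nm. Qed.

Let coef_mul_trunc m a b n : (n <= m)%N ->
  fps_coef (fps_mul a b) n = (trunc m a * trunc m b)`_n.
Proof.
move=> le_nm; rewrite coefM; apply: eq_bigr => i _.
have le_in : (i <= n)%N by rewrite -ltnS.
by rewrite !coef_trunc ?(leq_trans _ le_nm) // leq_subr.
Qed.

Lemma fps_mulC : commutative fps_mul.
Proof.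
by move=> a b; apply: fpsP => n; rewrite !(coef_mul_trunc _ _ (leqnn n)) mulrC.
Qed.

Lemma fps_mulA : associative fps_mul.
Proof.
move=> a b c; apply: fpsP => n.
transitivity (trunc n a * (trunc n b * trunc n c))`_n.
  rewrite coefM; apply: eq_bigr => i _.
  by rewrite -(coef_mul_trunc (m := n)) ?leq_subr // coef_trunc // -ltnS.
rewrite mulrA coefM; apply: eq_bigr => i _.
have le_in : (i <= n)%N by rewrite -ltnS.
by rewrite -(coef_mul_trunc (m := n)) // coef_trunc // leq_subr.
Qed.

Lemma fps_mul1 : left_id (fpsC 1) fps_mul.
Proof.
move=> a; apply: fpsP => n /=.
by rewrite big_ord_recl /= subn0 mul1r big1 ?addr0 // => i _; rewrite mul0r.
Qed.

Lemma fps_mulDl : left_distributive fps_mul fps_add.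
Proof.
move=> a b c; apply: fpsP => n /=; rewrite -big_split /=.
by apply: eq_bigr => i _; rewrite mulrDl.
Qed.

Lemma fps_1neq0 : fpsC 1 != fps_zero.
Proof.
by apply/eqP => /(congr1 (fun a => fps_coef a 0)) /= /eqP; rewrite oner_eq0.
Qed.

HB.instance Definition _ := GRing.Zmodule_isComNzRing.Build (fps R)
  fps_mulA fps_mulC fps_mul1 fps_mulDl fps_1neq0.

Lemma fpsC_is_zmod_morphism : zmod_morphism fpsC.
Proof. by move=> c d; apply: fpsP => -[|n] //=; rewrite subr0. Qed.

Lemma fpsC_is_monoid_morphism : monoid_morphism fpsC.
Proof.
split=> [//|c d]; apply: fpsP => n.
rewrite [RHS]/= big_ord_recl /= subn0 big1 => [|i _]; last by rewrite mul0r.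
by rewrite addr0; case: n => [|n] //=; rewrite mulr0.
Qed.

HB.instance Definition _ :=
  GRing.isZmodMorphism.Build R (fps R) fpsC fpsC_is_zmod_morphism.
HB.instance Definition _ :=
  GRing.isMonoidMorphism.Build R (fps R) fpsC fpsC_is_monoid_morphism.

Lemma fps_coef0 n : fps_coef (0 : fps R) n = 0.
Proof. by []. Qed.
Lemma fps_coefN a n : fps_coef (- a) n = - fps_coef a n.
Proof. by []. Qed.
Lemma fps_coefD a b n : fps_coef (a + b) n = fps_coef a n + fps_coef b n.
Proof. by []. Qed.
Lemma fps_coefB a b n : fps_coef (a - b) n = fps_coef a n - fps_coef b n.
Proof. by []. Qed.
Lemma fps_coefC (c : R) n : fps_coef (fpsC c) n = if n == 0%N then c else 0.
Proof. by []. Qed.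
Lemma fps_coef1 n : fps_coef (1 : fps R) n = (n == 0%N)%:R.
Proof. by case: n. Qed.
Lemma fps_coefM a b n :
  fps_coef (a * b) n = \sum_(i < n.+1) fps_coef a i * fps_coef b (n - i)%N.
Proof. by []. Qed.

End FpsRing.

Notation "c %:S" := (fpsC c) (at level 2, left associativity, format "c %:S")
  : ring_scope.

Section FpsUnit.
Variable R : comUnitRingType.
Implicit Types a b : fps R.

(* The first n + 1 coefficients of 1 / a. *)
Fixpoint fps_inv_seq a n : seq R :=
  if n is n'.+1 then
    let s := fps_inv_seq a n' in
    rcons s (- (fps_coef a 0)^-1 * \sum_(i < n) s`_i * fps_coef a (n - i)%N)
  else [:: (fps_coef a 0)^-1].

Definition fps_unit : {pred fps R} :=
  [pred a | fps_coef a 0 \is a GRing.unit].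

(* As usual for unitRingType, the inverse of a non-unit is itself. *)
Definition fps_inv a : fps R :=
  if a \in fps_unit then Fps (fun n => (fps_inv_seq a n)`_n) else a.

Let size_inv_seq a n : size (fps_inv_seq a n) = n.+1.
Proof. by elim: n => //= n IHn; rewrite size_rcons IHn. Qed.

Let nth_inv_seq a m n :
  (n <= m)%N -> (fps_inv_seq a m)`_n = (fps_inv_seq a n)`_n.
Proof.
elim: m => [|m IHm]; first by rewrite leqn0 => /eqP ->.
rewrite leq_eqVlt ltnS => /predU1P[-> //|le_nm].
by rewrite /= nth_rcons size_inv_seq ltnS le_nm IHm.
Qed.

Lemma fps_mulV : {in fps_unit, left_inverse 1 fps_inv *%R}.
Proof.
move=> a Ua; rewrite /fps_inv Ua; apply: fpsP => n.
rewrite fps_coefM fps_coef1 big_ord_recr /= subnn.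
case: n => [|n]; first by rewrite big_ord0 add0r mulVr.
rewrite /= nth_rcons size_inv_seq ltnn eqxx mulrAC mulNr mulVr // mulN1r.
apply/eqP; rewrite subr_eq0; apply/eqP/eq_bigr => i _.
by rewrite [in RHS]nth_inv_seq // -ltnS.
Qed.

Lemma fps_unitPl a b : b * a = 1 -> a \in fps_unit.
Proof.
move/(congr1 (fun c => fps_coef c 0)).
rewrite fps_coefM fps_coef1 big_ord_recl big_ord0 addr0 /= => ba1.
by rewrite inE; apply/unitrPr; exists (fps_coef b 0); rewrite mulrC.
Qed.

Lemma fps_inv_out : {in [predC fps_unit], fps_inv =1 id}.
Proof. by move=> a; rewrite inE /= /fps_inv => /negbTE ->. Qed.

HB.instance Definition _ := GRing.ComNzRing_hasMulInverse.Build (fps R)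
  fps_mulV fps_unitPl fps_inv_out.

Lemma fps_unitE a : (a \is a GRing.unit) = (fps_coef a 0 \is a GRing.unit).
Proof. by []. Qed.

(* The series e^{c x}. *)
Definition fps_expx (c : R) : fps R := Fps (fun n => c ^+ n / n`!%:R).

End FpsUnit.

(* The field Q(t). *)
Definition Qt : fieldType := {fraction {poly rat}}.
Definition t : Qt := FracField.tofrac 'X.

Section Desarrangements.
Variable n : nat.
Implicit Type s : 'S_n.

(* Values are those of 'I_n, i.e. shifted down by one; positions are 1-based:
   the entry in position i is the (i - 1)-th element of the sequence.         *)
Definition one_line s : seq nat := [seq val (s i) | i <- enum 'I_n].
Definition entry s (i : nat) : nat := nth 0%N (one_line s) i.-1.

Definition is_descent s (i : nat) : bool :=
  (1 <= i <= n.-1)%N && (entry s i.+1 < entry s i)%N.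
Definition des s : nat := count (is_descent s) (iota 1 n.-1).

Definition is_ascent s (i : nat) : bool :=
  (1 <= i <= n)%N && ~~ is_descent s i.
(* Since n is an ascent when 0 < n, the default value of head is only used for
   the empty permutation.                                                     *)
Definition first_ascent s : nat := head 0%N (filter (is_ascent s) (iota 1 n)).

Definition is_desarrangement s : bool := (n == 0%N) || ~~ odd (first_ascent s).
Definition desarrangements : {set 'S_n} := [set s | is_desarrangement s].

End Desarrangements.

Definition desarrangement_egf : fps Qt :=
  Fps (fun n => (\sum_(s in desarrangements n) t ^+ des s) / n`!%:R).

(* Main.v *)
(**
Let A_n be the Eulerian polynomial, the sum of t^des over S_n.  Permutations
whose first k entries decrease, weighted by t^des of the remaining n - k
entries only, sum to C(n,k) A_{n-k}.  Multiplying by z^k and summing over k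
yields n! times the coefficient of x^n in e^{zx} A(x), where A(x) is the
exponential generating function of the A_n.  On the other side, a permutation
of positive length contributes a sum over k from 0 to its first ascent, which
collapses to t * t^des for z = t - 1, and to (1 - t) t^des, minus
(1 - 2t) t^des when the first ascent is even, for z = -t.  Correcting the
constant terms gives
  (e^{(t-1)x} - t) A = 1 - t  and  (1 - 2t) D = (1 - t) A - e^{-tx} A + (1 - t),
from which A is eliminated.
*)
Require Import Defs.
From mathcomp Require Import all_boot all_order all_algebra all_fingroup.
From mathcomp Require Import zify ring.

Set Implicit Arguments.
Unset Strict Implicit.
Unset Printing Implicit Defensive.

Import GRing.Theory Num.Theory.
Local Open Scope ring_scope.

(** * Descents and the initial decreasing run of a sequence *)

Fixpoint seq_des (u : seq nat) : nat :=
  if u is x :: v then ((head x v < x)%N + seq_des v)%N else 0%N.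

(** For a nonempty sequence this is the first ascent: the default in [head x v] makes the last
    position an ascent. *)
Fixpoint initial_run (u : seq nat) : nat :=
  if u is x :: v then (if (head x v < x)%N then (initial_run v).+1 else 1%N)
  else 0%N.

Lemma initial_run_size u : (initial_run u <= size u)%N.
Proof. by elim: u => //= x v IHv; case: ifP. Qed.

Lemma initial_run_gt0 x v : (0 < initial_run (x :: v))%N.
Proof. by rewrite /=; case: ifP. Qed.

Lemma ltn_bump j a b : (bump j a < bump j b)%N = (a < b)%N.
Proof. by rewrite /bump; lia. Qed.

Lemma bump_lt j i : (bump j i < j)%N = (i < j)%N.
Proof. by rewrite /bump; lia. Qed.

Lemma seq_des_map_bump j u : seq_des (map (bump j) u) = seq_des u.
Proof.
elim: u => //= x [|y v] /= IHv; first by rewrite !ltnn.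
by rewrite IHv ltn_bump.
Qed.

Lemma initial_run_map_bump j u : initial_run (map (bump j) u) = initial_run u.
Proof.
elim: u => //= x [|y v] /= IHv; first by rewrite !ltnn.
by rewrite IHv ltn_bump.
Qed.

Lemma seq_des_count u :
  count (fun i => (1 <= i <= (size u).-1)%N && (nth 0 u i < nth 0 u i.-1)%N)
    (iota 1 (size u).-1) = seq_des u.
Proof.
elim: u => //= x [|y v] /= IHv; first by rewrite ltnn.
rewrite /= -IHv; congr addn.
rewrite (iotaDl 1 1) count_map; apply: eq_in_count => i.
by rewrite mem_iota => /andP[i_gt0 _] /=; case: i i_gt0.
Qed.

Lemma initial_run_head u :
  head 0%N
    [seq i <- iota 1 (size u) | (1 <= i <= size u)%N &&
      ~~ ((1 <= i <= (size u).-1)%N && (nth 0 u i < nth 0 u i.-1)%N)]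
  = initial_run u.
Proof.
have filter_iotaS P n : filter P (iota 1 n.+1)
    = (if P 1%N then [:: 1%N] else [::]) ++ map S (filter (P \o S) (iota 1 n)).
  by rewrite -filter_map -(iotaDl 1 1) /=; case: (P 1%N).
elim: u => [//|x [|y v] IHv]; first by rewrite /= ltnn.
have := initial_run_gt0 y v; rewrite -IHv.
set l := filter _ _ => l_gt0.
rewrite [size (x :: _)]/= filter_iotaS.
(* Shifting positions by one turns the ascent test of [x :: y :: v] into that of [y :: v]. *)
rewrite (_ : filter _ _ = l); last first.
  by apply: eq_in_filter => -[|i]; rewrite ?mem_iota.
rewrite [in RHS]/= -/(initial_run (y :: v)) -IHv -/l /=.
by case: (y < x)%N => //=; case: (l) l_gt0.
Qed.

Lemma sum_bin n k : (\sum_(i < n) 'C(i, k) = 'C(n, k.+1))%N.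
Proof.
elim: n => [|n IHn]; first by rewrite big_ord0 bin0n.
by rewrite big_ord_recr /= IHn binS.
Qed.

(** * Sums over permutations, split by the first value *)

Section PermutationSums.
Variable R : comNzRingType.

Definition perm_sum n (F : seq nat -> R) : R := \sum_(s : 'S_n) F (one_line s).

Lemma eq_perm_sum n F F' :
  (forall u, size u = n -> F u = F' u) -> perm_sum n F = perm_sum n F'.
Proof.
by move=> eqF; apply: eq_bigr => s _; rewrite eqF // size_map size_enum_ord.
Qed.

Lemma one_line_lift n (j : 'I_n.+1) (s : 'S_n) :
  one_line (lift_perm ord0 j s) = val j :: map (bump j) (one_line s).
Proof.
rewrite /one_line enum_ordSl /= lift_perm_id; congr cons.
by rewrite -!map_comp; apply: eq_map => i /=; rewrite lift_perm_lift.
Qed.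

Lemma perm_sum0 F : perm_sum 0 F = F [::].
Proof.
rewrite /perm_sum (bigD1 1%g) //= big1 ?addr0; last first.
  by move=> s /eqP[]; apply/permP => -[].
by congr F; apply: size0nil; rewrite size_map size_enum_ord.
Qed.

(** Removing the first entry [j] and closing the gap among the values is a bijection onto ['S_n];
    [bump j] reopens the gap and preserves order. *)
Lemma perm_sumS n F :
  perm_sum n.+1 F
  = \sum_(j < n.+1) perm_sum n (fun u => F (val j :: map (bump j) u)).
Proof.
rewrite /perm_sum (partition_big (fun s : 'S_n.+1 => s ord0) predT) //=.
apply: eq_bigr => j _.
rewrite (reindex (lift_perm ord0 j)).
  by apply: eq_big => s; rewrite ?lift_perm_id ?eqxx // one_line_lift.
(* The default [k] is never taken: by injectivity [s (lift ord0 k)] differs from [s ord0]. *)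
pose lowerf (s : 'S_n.+1) k := odflt k (unlift (s ord0) (s (lift ord0 k))).
have lowerf_inj s : injective (lowerf s).
  pose raisef k := odflt k (unlift ord0 ((s^-1)%g (lift (s ord0) k))).
  apply: (can_inj (g := raisef)) => k; rewrite /raisef.
  rewrite /lowerf.
  have ne: s ord0 != s (lift ord0 k) by rewrite (inj_eq perm_inj) neq_lift.
  by case: (unlift_some ne) => k' e ->; rewrite /= -e permK liftK.
exists (fun s => perm (@lowerf_inj s)) => s.
  move=> _; apply/permP => k.
  by rewrite permE /lowerf lift_perm_id lift_perm_lift liftK.
rewrite inE => /eqP sj; apply/permP => k.
case: (unliftP ord0 k) => [k'|] ->; last by rewrite lift_perm_id.
rewrite lift_perm_lift permE /lowerf sj.
have ne: j != s (lift ord0 k') by rewrite -sj (inj_eq perm_inj) neq_lift.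
by case: (unlift_some ne) => i e ->.
Qed.

Lemma perm_sum_mull n c F : c * perm_sum n F = perm_sum n (fun u => c * F u).
Proof. exact: mulr_sumr. Qed.

Lemma perm_sumB n F F' :
  perm_sum n F - perm_sum n F' = perm_sum n (fun u => F u - F' u).
Proof. by rewrite /perm_sum -sumrB. Qed.

(** * Eulerian polynomials and permutations with a decreasing prefix *)

Variable q : R.

Definition eulerian n := perm_sum n (fun u => q ^+ seq_des u).

(* With first value j, the other k entries of the decreasing prefix are chosen
   among the j smaller values. *)
Lemma eulerian_run_first n k (j : nat) : (j <= n)%N ->
  perm_sum n (fun u => (k < initial_run (j :: map (bump j) u))%:R
                        * q ^+ seq_des (drop k (map (bump j) u)))
  = 'C(j, k)%:R * eulerian (n - k).
Proof.
elim: k n j => [|k IHk] n j le_jn.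
  rewrite bin0 mul1r subn0; apply: eq_perm_sum => u _.
  by rewrite initial_run_gt0 mul1r drop0 seq_des_map_bump.
case: n le_jn => [|n] le_jn.
  by move: le_jn; rewrite leqn0 perm_sum0 => /eqP ->; rewrite /= !mul0r.
rewrite perm_sumS subSS.
(* Since [bump j i < j] iff [i < j], the run goes on past [j] only for these next values [i], to
   which the induction hypothesis applies. *)
transitivity (\sum_(i < n.+1 | (i < j)%N) 'C(i, k)%:R * eulerian (n - k)).
  rewrite [RHS]big_mkcond; apply: eq_bigr => i _.
  have [lt_ij|le_ji] := ltnP i j.
    rewrite -IHk; last by rewrite -ltnS.
    apply: eq_perm_sum => u _.
    rewrite -[in RHS](initial_run_map_bump j) /= bump_lt lt_ij ltnS.
    by rewrite -map_drop seq_des_map_bump.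
  rewrite /perm_sum big1 // => s _.
  by rewrite /= bump_lt [(i < j)%N]ltnNge le_ji mul0r.
rewrite -mulr_suml -natr_sum; congr (_%:R * _).
by rewrite -(big_ord_widen _ (fun i => 'C(i, k)) le_jn) sum_bin.
Qed.

(** For positive [k], summing [eulerian_run_first] over the first value gives the binomial
    coefficient by the hockey-stick identity [sum_bin]. *)
Lemma eulerian_run n k :
  perm_sum n (fun u => (k <= initial_run u)%:R * q ^+ seq_des (drop k u))
  = 'C(n, k)%:R * eulerian (n - k).
Proof.
case: k => [|k].
  by rewrite bin0 mul1r subn0; apply: eq_perm_sum => u _; rewrite drop0 mul1r.
case: n => [|n]; first by rewrite perm_sum0 /= !mul0r.
rewrite perm_sumS subSS -sum_bin natr_sum mulr_suml.
by apply: eq_bigr => j _; rewrite -eulerian_run_first // -ltnS.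
Qed.

Definition run_sum (z : R) (u : seq nat) : R :=
  \sum_(k < (initial_run u).+1) z ^+ k * q ^+ seq_des (drop k u).

Lemma perm_sum_run_sum n z :
  perm_sum n (run_sum z)
  = \sum_(k < n.+1) 'C(n, k)%:R * z ^+ k * eulerian (n - k).
Proof.
transitivity (perm_sum n (fun u => \sum_(k < n.+1)
    z ^+ k * ((k <= initial_run u)%:R * q ^+ seq_des (drop k u)))).
  apply: eq_perm_sum => u size_u.
  have le_run : (initial_run u < n.+1)%N by rewrite ltnS -size_u initial_run_size.
  pose f k := z ^+ k * q ^+ seq_des (drop k u).
  rewrite /run_sum (big_ord_widen _ f le_run).
  rewrite big_mkcond; apply: eq_bigr => k _; rewrite ltnS.
  by case: ifP => _; rewrite ?mul1r // mul0r mulr0.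
rewrite /perm_sum exchange_big; apply: eq_bigr => k _ /=.
by rewrite -mulr_sumr [X in _ * X]eulerian_run mulrA [z ^+ k * _]mulrC.
Qed.

Lemma run_sum_cons z x v :
  run_sum z (x :: v) = q ^+ seq_des (x :: v)
    + z * (if (head x v < x)%N then run_sum z v else q ^+ seq_des v).
Proof.
rewrite /run_sum big_ord_recl mul1r drop0; congr (_ + _).
rewrite /=; case: ifP => _.
  by rewrite mulr_sumr; apply: eq_bigr => k _; rewrite exprS mulrA.
by rewrite big_ord1 drop0.
Qed.

(** The factor of [z] in [run_sum_cons] is [q ^+ seq_des (x :: v)] in both cases, by induction after
    a descent and directly after an ascent; then [1 + z = q]. *)
Lemma run_sum_subr1 x v :
  run_sum (q - 1) (x :: v) = q * q ^+ seq_des (x :: v).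
Proof.
elim: v x => [|y v IHv] x; rewrite run_sum_cons /=.
  by rewrite ltnn; ring.
by case: ifP => _; rewrite ?IHv /= ?add0n ?add1n ?exprS; ring.
Qed.

(** The coefficient of [q ^+ seq_des (x :: v)] is [1 - q] for a run of length 1, and each further
    descent replaces [c] by [1 - c], so it alternates between [1 - q] and [q] with the parity of the
    run. *)
Lemma run_sum_opp x v :
  run_sum (- q) (x :: v)
  = (1 - q - (1 - 2%:R * q) * (~~ odd (initial_run (x :: v)))%:R)
    * q ^+ seq_des (x :: v).
Proof.
elim: v x => [|y v IHv] x; rewrite run_sum_cons /=.
  by rewrite ltnn /=; ring.
case: ifP => _; last by rewrite /= add0n; ring.
rewrite IHv /= add1n exprS.
by case: (odd (if _ then _ else _)) => /=; ring.
Qed.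

(** The empty sequence has run 0, which is even, so it counts as a desarrangement. *)
Definition desarrangement_sum n :=
  perm_sum n (fun u => (~~ odd (initial_run u))%:R * q ^+ seq_des u).

(** Positivity of [n] excludes the empty sequence, whose [run_sum] is 1 rather than [q]. *)
Lemma eulerian_rec n : (0 < n)%N ->
  \sum_(k < n.+1) 'C(n, k)%:R * (q - 1) ^+ k * eulerian (n - k)
  = q * eulerian n.
Proof.
move=> n_gt0; rewrite -perm_sum_run_sum perm_sum_mull.
by apply: eq_perm_sum => -[|x v] size_u; [case: n size_u n_gt0|exact: run_sum_subr1].
Qed.

Lemma desarrangement_sum_rec n : (0 < n)%N ->
  \sum_(k < n.+1) 'C(n, k)%:R * (- q) ^+ k * eulerian (n - k)
  = (1 - q) * eulerian n - (1 - 2%:R * q) * desarrangement_sum n.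
Proof.
move=> n_gt0; rewrite -perm_sum_run_sum !perm_sum_mull perm_sumB.
apply: eq_perm_sum => -[|x v] size_u; first by case: n size_u n_gt0.
by rewrite run_sum_opp mulrBl mulrA.
Qed.

Lemma eulerian0 : eulerian 0 = 1.
Proof. exact: perm_sum0. Qed.

Lemma desarrangement_sum0 : desarrangement_sum 0 = 1.
Proof. by rewrite /desarrangement_sum perm_sum0 mul1r. Qed.

End PermutationSums.

Lemma des_one_line n (s : 'S_n) : des s = seq_des (one_line s).
Proof.
by rewrite -seq_des_count /des /is_descent /entry size_map size_enum_ord.
Qed.

Lemma first_ascent_one_line n (s : 'S_n) :
  first_ascent s = initial_run (one_line s).
Proof.
rewrite -initial_run_head /first_ascent /is_ascent /is_descent /entry.
by rewrite size_map size_enum_ord.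
Qed.

(** * Exponential generating functions over a field of characteristic 0 *)

Section GeneratingFunctions.
Variables (F : fieldType) (q : F).
Hypothesis pcharF0 : [pchar F] =i pred0.

Definition eulerian_egf : fps F := Fps (fun n => eulerian q n / n`!%:R).
Definition desarrangement_sum_egf : fps F :=
  Fps (fun n => desarrangement_sum q n / n`!%:R).

Lemma fps_coefCM (c : F) a n : fps_coef (c%:S * a) n = c * fps_coef a n.
Proof.
by rewrite fps_coefM big_ord_recl /= subn0 big1 ?addr0 // => i _; rewrite mul0r.
Qed.

Lemma coef_expx_eulerian_egf z n :
  fps_coef (fps_expx z * eulerian_egf) n
  = (\sum_(k < n.+1) 'C(n, k)%:R * z ^+ k * eulerian q (n - k)) / n`!%:R.
Proof.
have natr_neq0 m : (0 < m)%N -> m%:R != 0 :> F.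
  by move=> m_gt0; rewrite ((pcharf0P F).1 pcharF0) -lt0n.
rewrite fps_coefM mulr_suml; apply: eq_bigr => k _ /=.
have le_kn : (k <= n)%N by rewrite -ltnS.
rewrite -(bin_fact le_kn) !natrM.
by field; rewrite !natr_neq0 ?fact_gt0 ?bin_gt0.
Qed.

Lemma eulerian_egf_eq : (fps_expx (q - 1) - q%:S) * eulerian_egf = (1 - q)%:S.
Proof.
apply: fpsP => n; rewrite mulrBl fps_coefB coef_expx_eulerian_egf fps_coefCM.
rewrite fps_coefC; case: n => [|n] /=.
  by rewrite big_ord1 subn0 eulerian0 bin0 fact0 expr0 !divr1; ring.
by rewrite eulerian_rec // mulrA subrr.
Qed.

Lemma desarrangement_sum_egf_eq :
  (1 - 2%:R * q)%:S * desarrangement_sum_egf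
  = (1 - q)%:S * eulerian_egf - fps_expx (- q) * eulerian_egf + (1 - q)%:S.
Proof.
apply: fpsP => n; rewrite fps_coefD fps_coefB coef_expx_eulerian_egf !fps_coefCM.
rewrite fps_coefC; case: n => [|n] /=.
  rewrite big_ord1 subn0 eulerian0 desarrangement_sum0 bin0 fact0 expr0.
  by rewrite !divr1; ring.
by rewrite desarrangement_sum_rec // addr0; ring.
Qed.

Lemma desarrangement_sum_egfE : 1 - q != 0 -> 1 - 2%:R * q != 0 ->
  desarrangement_sum_egf =
    (1 - q%:S) * (1 - 2%:R * q%:S - fps_expx (- q) + fps_expx (q - 1)) /
    ((1 - 2%:R * q%:S) * (fps_expx (q - 1) - q%:S)).
Proof.
move=> q_neq1 q2_neq1.
have C1 : (1 - q)%:S = 1 - q%:S by rewrite rmorphB rmorph1.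
have C2 : (1 - 2%:R * q)%:S = 1 - 2%:R * q%:S.
  by rewrite rmorphB rmorphM rmorph1 rmorph_nat.
(* The constant terms of the two factors are [1 - 2%:R * q] and [1 - q], both nonzero. *)
have U : (1 - 2%:R * q%:S) * (fps_expx (q - 1) - q%:S) \is a GRing.unit.
  rewrite unitrM -C2 !fps_unitE fps_coefB !fps_coefC /= expr0 fact0 divr1.
  by rewrite !unitfE q2_neq1.
apply: (canRL (mulrK U)); rewrite mulrA [desarrangement_sum_egf * _]mulrC.
rewrite -C2 desarrangement_sum_egf_eq C1 C2.
have := eulerian_egf_eq; rewrite C1.
move: (fps_expx (- q)) (fps_expx (q - 1)) q%:S eulerian_egf => e f c A fcA.
(* Regrouped so that [A] occurs only in [(f - c) * A], which [fcA] replaces by [1 - c]. *)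
have -> : ((1 - c) * A - e * A + (1 - c)) * (f - c)
  = (1 - c - e) * ((f - c) * A) + (1 - c) * (f - c) by ring.
by rewrite fcA; ring.
Qed.

End GeneratingFunctions.

(** * Specialization to [t] in the field of rational functions *)

Lemma desarrangement_egf_sum : desarrangement_egf = desarrangement_sum_egf t.
Proof.
apply: fpsP => n /=; congr (_ / _); rewrite big_mkcond; apply: eq_bigr => s _.
rewrite inE /is_desarrangement first_ascent_one_line des_one_line.
case: eqP => [n0|_] /=; last by case: odd; rewrite ?mul1r ?mul0r.
rewrite (size0nil (_ : size (one_line s) = 0%N)) ?mul1r //.
by rewrite size_map size_enum_ord.
Qed.

Lemma pchar_Qt : [pchar Qt] =i pred0.
Proof.
apply/pcharf0P => n; rewrite -(rmorph_nat (@FracField.tofrac {poly rat})).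
by rewrite tofrac_eq0 -polyC_natr polyC_eq0 pnatr_eq0.
Qed.

Lemma Qt_1subt_neq0 : 1 - t != 0.
Proof.
rewrite -(rmorph1 (@FracField.tofrac {poly rat})) -rmorphB tofrac_eq0.
by rewrite -opprB oppr_eq0 polyXsubC_eq0.
Qed.

Lemma Qt_1sub2t_neq0 : 1 - 2%:R * t != 0.
Proof.
rewrite -(rmorph1 (@FracField.tofrac {poly rat})).
rewrite -(rmorph_nat (@FracField.tofrac {poly rat})) -rmorphM -rmorphB tofrac_eq0.
(* At 0 the polynomial takes the value 1, so it is not zero. *)
apply/eqP => /(congr1 (fun p : {poly rat} => p.[0])) /eqP.
by rewrite !hornerE oner_eq0.
Qed.

Theorem theorem2p1 :
  desarrangement_egf =
    (1 - t%:S) * (1 - 2%:R * t%:S - fps_expx (- t) + fps_expx (t - 1)) /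
    ((1 - 2%:R * t%:S) * (fps_expx (t - 1) - t%:S)).
Proof.
rewrite desarrangement_egf_sum.
exact: desarrangement_sum_egfE pchar_Qt Qt_1subt_neq0 Qt_1sub2t_neq0.
Qed.
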